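(* Let $\mathcal A\colon\mathcal X\to\mathcal X'$ be Fréchet differentiable, strongly monotone (constant $\alpha$), locally Lipschitz continuous (constants $L[\vartheta]$), with uniformly coercive derivative (constant $\beta$) and locally Lipschitz continuous derivative (constants $M[\vartheta]$). Let $F\in\mathcal X'$, let $\mathcal X_H\subseteq\mathcal X$ be a closed subspace, and let $u_H^0\in\mathcal X_H$ satisfy $\|u_H^0\|_{\mathcal X}\le c_0B_0$ for some constant $c_0>1$, where $B_0:=\alpha^{-1}\|F-\mathcal A0\|_{\mathcal X'}$; set $\overline B_0:=\alpha^{-1}L[(1+c_0)B_0](1+c_0)B_0+B_0$. Then the output sequence $(u_H^k)_{k\in\mathbb N_0}$ and $\delta_{\min}>0$ of the adaptively damped Newton iteration (described in the context) with initial guess $u_H^0$ satisfy: (i) (Bounded iterates) $\|u_H^k\|_{\mathcal X}\le\overline B_0$ for all $k\in\mathbb N_0$. (ii) (Guaranteed reduction) There exists a uniform lower bound $0<\delta_0\le\delta_{\min}$ such that $\overline r_0:=1-\delta_0^{3/2}/2<1$ satisfies $$\|F-\mathcal A u_H^{k+1}\|_{\mathcal X_H'}\le\overline r_0\,\|F-\mathcal A u_H^k\|_{\mathcal X_H'}\quad\text{for all }k\in\mathbb N_0.$$ (iii) (Quadratic convergence) There exists a uniform $k_0\in\mathbb N_0$ such that, with the step size $\delta=1$, $$\|F-\mathcal A(u_H^k+\varrho_H^k)\|_{\mathcal X_H'}\le\min\Big\{1-2^{-5/2},\ \frac{M[\overline B_0]}{2\beta^2}\,\|F-\mathcal A u_H^k\|_{\mathcal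 X_H'}\Big\}\,\|F-\mathcal A u_H^k\|_{\mathcal X_H'}\quad\text{for all }k\ge k_0.$$ Moreover, the constants $\delta_0$, $\overline r_0$, and $k_0$ are independent of the subspace $\mathcal X_H$.
   Context: $\mathcal X$ is a (real) Hilbert space with norm $\|\cdot\|_{\mathcal X}$ induced by its inner product, $\mathcal X'$ is its topological dual with dual norm $\|\cdot\|_{\mathcal X'}$, $\langle\cdot,\cdot\rangle$ is the duality pairing on $\mathcal X'\times\mathcal X$. For a closed subspace $\mathcal X_H\subseteq\mathcal X$ and $\phi\in\mathcal X'$, $\|\phi\|_{\mathcal X_H'}:=\sup\{\langle\phi,w_H\rangle: w_H\in\mathcal X_H,\ \|w_H\|_{\mathcal X}=1\}$. The Fréchet derivative of $\mathcal A$ at $v$ is $\mathrm d\mathcal A[v]\in\mathcal L(\mathcal X,\mathcal X')$. Assumptions: - Strong monotonicity: $\alpha>0$ and $\alpha\|v-w\|_{\mathcal X}^2\le\langle\mathcal A v-\mathcal A w,v-w\rangle$ for all $v,w\in\mathcal X$. - Local Lipschitz continuity: for all $\vartheta>0$ there is $L[\vartheta]>0$ with $\langle\mathcal A v-\mathcal A w,\varphi\rangle\le L[\vartheta]\|v-w\|_{\mathcal X}\|\varphi\|_{\mathcal X}$ for all $v,w,\varphi\in\mathcal X$ with $\max\{\|v\|_{\mathcal X},\|v-w\|_{\mathcal X}\}\le\vartheta$. - Uniform coercivity of the derivative: $\beta>0$ and $\beta\|w\|_{\mathcal X}^2\le\langle\mathrm d\mathcal A[v]w,w\rangle$ for all $v,w\in\mathcal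 X$. - Local Lipschitz continuity of the derivative: for all $\vartheta>0$ there is $M[\vartheta]>0$ with $\|\mathrm d\mathcal A[v]-\mathrm d\mathcal A[w]\|_{\mathcal L(\mathcal X,\mathcal X')}\le M[\vartheta]\|v-w\|_{\mathcal X}$ for all $v,w\in\mathcal X$ with $\max\{\|v\|_{\mathcal X},\|v-w\|_{\mathcal X}\}\le\vartheta$; $M[\cdot]$ is monotonically increasing and bounded below by a positive constant. - Standing assumption: $\mathcal A0\ne F$, so $B_0>0$. Adaptively damped Newton iteration. Input: $u_H^0\in\mathcal X_H$ and initial value $\delta_{\min}:=1/2$. For $k=0,1,2,\dots$: (a) compute $\varrho_H^k\in\mathcal X_H$ solving $\langle\mathrm d\mathcal A[u_H^k]\varrho_H^k,v_H\rangle=\langle F-\mathcal A u_H^k,v_H\rangle$ for all $v_H\in\mathcal X_H$; (b) initialize $\delta:=1$; as long as the criterion $$\|F-\mathcal A(u_H^k+\delta\varrho_H^k)\|_{\mathcal X_H'}\le(1-\delta_{\min}^{3/2}/2)\,\|F-\mathcal A u_H^k\|_{\mathcal X_H'}$$ (with the current values of $\delta$ and $\delta_{\min}$) is not met, replace $\delta$ by $\delta/2$ and then $\delta_{\min}$ by $\min\{\delta,\delta_{\min}\}$; (c) set $\delta_H^k:=\delta$ and $u_H^{k+1}:=u_H^k+\delta_H^k\varrho_H^k$. The value $\delta_{\min}$ is carried over from step $k$ to step $k+1$; the output $\delta_{\min}$ is its overall minimum over the whole iteration. ''Uniform/independent of the subspace'' means that, for fixed $\mathcal A,F,c_0$, the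 constants can be chosen simultaneously for all closed subspaces $\mathcal X_H$ (with initial guesses $u_H^0\in\mathcal X_H$ satisfying $\|u_H^0\|_{\mathcal X}\le c_0B_0$). *)

(* Defs.v *)
From HB Require Import structures.
From mathcomp Require Import all_boot all_order all_algebra sesquilinear.
From mathcomp Require Import all_classical all_reals all_analysis.

Set Implicit Arguments.
Unset Strict Implicit.
Unset Printing Implicit Defensive.

Import Order.TTheory GRing.Theory Num.Theory.
Import numFieldNormedType.Exports.

Local Open Scope classical_set_scope.
Local Open Scope ring_scope.

Section Dual.
Variables (R : realType) (X : normedModType R).

(* The codomain is the regular module [R^o] (convertible to [R]) so that
   [X -> R^o] has a left-module structure for [dual] to inherit. *)
Definition continuous_form : {pred X -> R^o} :=
  mem [set f : X -> R^o | scalar f /\ continuous f].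

Record dual := Dual { dual_fun :> X -> R^o; _ : dual_fun \in continuous_form }.

HB.instance Definition _ := [isSub for dual_fun].
HB.instance Definition _ := [Choice of dual by <:].

Lemma continuous_form_submod : submod_closed continuous_form.
Proof.
split=> [|a f g].
  by rewrite inE; split=> [b x y|]; [rewrite /= mulr0 addr0|exact: cst_continuous].
rewrite !inE => -[fL fC] [gL gC]; split.
  move=> b x y; rewrite /= !fctE fL gL /GRing.scale /=.
  by rewrite !mulrDr addrACA (mulrCA a b).
by move=> x; apply: cvgD; [apply: cvgZl_tmp; exact: fC|exact: gC].
Qed.

HB.instance Definition _ :=
  GRing.isSubmodClosed.Build _ _ continuous_form continuous_form_submod.
HB.instance Definition _ := [SubChoice_isSubLmodule of dual by <:].

(* [sup set0 = 0], so the value for the zero subspace is 0. *)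
Definition norm_on (S : set X) (phi : dual) : R :=
  sup [set (phi w : R) | w in [set w | S w /\ `|w| = 1]].

Local Notation N := (norm_on setT).

Lemma dual_scalar (phi : dual) : scalar phi.
Proof. by case: phi => f /= fP; have := fP; rewrite inE => -[]. Qed.

Lemma dual_continuous (phi : dual) : continuous phi.
Proof. by case: phi => f /= fP; have := fP; rewrite inE => -[]. Qed.

Lemma dual0 (phi : dual) : phi 0 = 0.
Proof.
by have := dual_scalar phi 1 0 0; rewrite scale1r addr0 mul1r => /eqP;
  rewrite eq_sym -subr_eq0 addrK => /eqP.
Qed.

Lemma dualZ (phi : dual) a w : phi (a *: w) = a * phi w.
Proof. by rewrite -[a *: w]addr0 dual_scalar dual0 addr0. Qed.

Lemma dual_bounded (phi : dual) : exists k : R, forall w, `|phi w| <= k * `|w|.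
Proof.
pose pf : {linear X -> R^o} := HB.pack (phi : X -> R^o)
  (GRing.isLinear.Build _ _ _ _ (phi : X -> R^o) (dual_scalar phi)).
have /linear_bounded_continuous/linear_boundedP : continuous pf
  by exact: dual_continuous.
by move=> /pinfty_ex_gt0[k _ kP]; exists k.
Qed.

Lemma norm_on_ubound S (phi : dual) :
  has_ubound [set (phi w : R) | w in [set w | S w /\ `|w| = 1]].
Proof.
have [k kP] := dual_bounded phi; exists k => _ [w [_ w1] <-].
by rewrite (le_trans (ler_norm _))// (le_trans (kP w))// w1 mulr1.
Qed.

Lemma dual_le_norm (phi : dual) w : phi w <= N phi * `|w|.
Proof.
have [->|w0] := eqVneq w 0; first by rewrite dual0 normr0 mulr0.
have nw : 0 < `|w| by rewrite normr_gt0.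
rewrite -[w in phi w](scalerKV (a := `|w|)) ?gt_eqF// dualZ mulrC.
rewrite ler_pM2r//; apply: ub_le_sup; first exact: norm_on_ubound.
exists (`|w|^-1 *: w) => //; split=> //.
by rewrite normrZ normfV normr_id mulVf// gt_eqF.
Qed.

Lemma norm_le (phi : dual) (c : R) :
  0 <= c -> (forall w, phi w <= c * `|w|) -> N phi <= c.
Proof.
move=> c0 cP; rewrite /norm_on; set A := image _ _.
have [->|/set0P A0] := eqVneq A set0; first by rewrite sup0.
by apply: ge_sup => // _ [w [_ w1] <-]; rewrite (le_trans (cP w))// w1 mulr1.
Qed.

Lemma norm_ge0 (phi : dual) : 0 <= N phi.
Proof.
rewrite /norm_on; set A := image _ _.
have [->|/set0P [_ [w [_ w1] _]]] := eqVneq A set0; first by rewrite sup0.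
have := dual_le_norm phi w; have := dual_le_norm phi (-1 *: w).
rewrite dualZ normrZ normrN1 mul1r w1 !mulr1 mulN1r lerNl => h1 h2.
by have := le_trans h1 h2; rewrite -subr_ge0 opprK -mulr2n pmulrn_lge0.
Qed.

Lemma dual_normD (phi psi : dual) : N (phi + psi) <= N phi + N psi.
Proof.
apply: norm_le => [|w]; first by rewrite addr_ge0 ?norm_ge0.
by rewrite mulrDl; apply: lerD; exact: dual_le_norm.
Qed.

Lemma dual_normZ_le a (phi : dual) : N (a *: phi) <= `|a| * N phi.
Proof.
apply: norm_le => [|w]; first by rewrite mulr_ge0 ?norm_ge0.
rewrite (_ : (a *: phi) w = phi (a *: w)); last by rewrite dualZ.
by rewrite (le_trans (dual_le_norm _ _))// normrZ mulrCA mulrA.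
Qed.

Lemma dual_normZ a (phi : dual) : N (a *: phi) = `|a| * N phi.
Proof.
apply/le_anti; rewrite dual_normZ_le /=.
have [->|a0] := eqVneq a 0; first by rewrite normr0 mul0r norm_ge0.
rewrite -[in leLHS](scalerK a0 phi) -ler_pdivlMl ?normr_gt0//.
by rewrite -normfV dual_normZ_le.
Qed.

Lemma dual_norm0_eq0 (phi : dual) : N phi = 0 -> phi = 0.
Proof.
move=> N0; apply: val_inj; apply/funext => w /=; apply/le_anti.
have := dual_le_norm phi w; have := dual_le_norm phi (-1 *: w).
by rewrite N0 !mul0r dualZ mulN1r oppr_le0 => -> ->.
Qed.

HB.instance Definition _ :=
  Lmodule_isNormed.Build R dual dual_normD dual_normZ dual_norm0_eq0.

Lemma dual_normE (phi : dual) : `|phi| = norm_on setT phi.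
Proof. by []. Qed.

End Dual.

Section OperatorNorm.
Variables (R : realType) (X Y : normedModType R).

Definition operator_norm (f : X -> Y) : R :=
  sup [set `|f w| | w in [set w | `|w| = 1]].

End OperatorNorm.

Section DampedNewton.
Variables (R : realType) (X : normedModType R).
Variables (A : X -> dual X) (F : dual X) (XH : set X).

Definition closed_subspace : Prop := submod_closed (mem XH) /\ closed XH.

Definition residual (u : X) : R := norm_on XH (F - A u).

Definition newton_update (u rho : X) : Prop :=
  XH rho /\ forall v, XH v -> ('d A u rho : dual X) v = (F - A u) v.

Definition reduction_criterion (u rho : X) (delta dmin : R) : Prop :=
  residual (u + delta *: rho) <= (1 - dmin `^ (3 / 2) / 2) * residual u.

(* [damping u rho delta dmin delta' dmin']: the loop, entered with the values
   [delta] and [dmin], terminates with the values [delta'] and [dmin']. *)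
Inductive damping (u rho : X) : R -> R -> R -> R -> Prop :=
| damping_stop delta dmin :
    reduction_criterion u rho delta dmin -> damping u rho delta dmin delta dmin
| damping_halve delta dmin delta' dmin' :
    ~ reduction_criterion u rho delta dmin ->
    damping u rho (delta / 2) (Num.min (delta / 2) dmin) delta' dmin' ->
    damping u rho delta dmin delta' dmin'.

(* [dmin k] is the value held when step [k] starts. *)
Record damped_newton (u0 : X) (u rho : nat -> X) (delta dmin : nat -> R)
    : Prop := DampedNewton {
  newton_init : u 0%N = u0;
  newton_dmin_init : dmin 0%N = 1 / 2;
  newton_solve : forall k, newton_update (u k) (rho k);
  newton_damp : forall k,
    damping (u k) (rho k) 1 (dmin k) (delta k) (dmin k.+1);
  newton_step : forall k, u k.+1 = u k + delta k *: rho k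
}.

End DampedNewton.

Definition is_minimum (R : realType) (a : nat -> R) (m : R) : Prop :=
  (exists k, a k = m) /\ forall k, m <= a k.

(* Main.v *)
Require Import Defs.
From mathcomp Require Import all_boot all_order all_algebra sesquilinear.
From mathcomp Require Import all_classical all_reals all_analysis.
From mathcomp Require Import ring lra.

Set Implicit Arguments.
Unset Strict Implicit.
Unset Printing Implicit Defensive.

Import Order.TTheory GRing.Theory Num.Theory.
Import numFieldNormedType.Exports.

Local Open Scope classical_set_scope.
Local Open Scope ring_scope.

(** Write r(u) for the norm of the functional F - A u on the closed subspace,
    and let rho be the Newton update at u. Everything rests on one estimate,
    [damped_residual_le]: for 0 <= delta <= 1,
      r(u + delta rho) <= (1 - delta + C delta^2) r(u),
      C = M[th] r(u) / (2 beta^2).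
    On the subspace the linear part of A along rho reproduces the residual,
    which leaves the factor 1 - delta; the remainder is of second order because
    the derivative is Lipschitz, and |rho| <= r(u) / beta by coercivity. The
    radius th has to dominate both |u| and r(u) / beta.

    Damping. The loop keeps dmin <= delta <= 1, so dmin^(3/2) <= delta. Hence
    the criterion holds as soon as C delta <= 1/2, because then
      delta - C delta^2 >= delta / 2 >= dmin^(3/2) / 2.
    Both delta and dmin are powers of 1/2; if C 2^-J <= 1/2, a halving can only
    happen before delta has reached 2^-J, so every value of dmin is at least
    delta0 := 2^-J, and each step reduces the residual by the factor
    rbar0 := 1 - delta0^(3/2) / 2.

    Uniformity. Testing strong monotonicity between u and 0 with u and using the
    Lipschitz bound at the initial guess give
      |u| <= r(u) / alpha + B0 ([norm_le_residual]),
      r(u_0) <= R0 := L[(1 + c0) B0] (1 + c0) B0 ([initial_residual_le]).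
    As the residuals decrease, all iterates stay in the ball of radius
    R0 / alpha + B0, which is the bound of the theorem. So C can be bounded with
    th and r(u) replaced by quantities that depend only on alpha, beta, M, B0
    and R0, and then J and delta0 do not depend on the subspace.

    Quadratic convergence. The residuals are at most rbar0^k R0. Past a uniform
    k0 they are so small that r / beta is below the radius of that ball, which
    allows th to be this radius, and that M r / (2 beta^2) <= 1 - 2^(-5/2). The
    estimate with delta = 1 is then the claim.

    That the iteration can be run at all needs a solution of the non-symmetric
    Newton equation on the subspace. It comes from [lax_milgram], which is
    derived from the Riesz representation on a closed subspace, [riesz], by
    Banach's fixed point theorem. *)

(** * Functionals on a closed subspace *)

Section DualForm.
Variables (R : realType) (X : normedModType R).
Implicit Types (S : set X) (phi psi : dual X).

(** Functionals take their values in the regular module [R^o]. The right-hand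
    sides below name the operations of [R], so that rewriting yields terms that
    the arithmetic tactics recognise. *)
Lemma dualDr phi v w : phi (v + w) = @Algebra.add R (phi v) (phi w).
Proof. by rewrite -{1}(scale1r v) dual_scalar mul1r. Qed.

Lemma dualZr phi a v : phi (a *: v) = @GRing.mul R a (phi v).
Proof. exact: dualZ. Qed.

Lemma dualBl phi psi v : (phi - psi) v = @Algebra.add R (phi v) (- psi v).
Proof. by []. Qed.

Lemma dual_le phi v : phi v <= `|phi| * `|v|.
Proof. exact: dual_le_norm. Qed.

Lemma closed_subspace0 S : closed_subspace S -> S 0.
Proof. by move=> [[/set_mem]]. Qed.

Lemma closed_subspaceDZ S a v w :
  closed_subspace S -> S v -> S w -> S (a *: v + w).
Proof.
by move=> [[_ SP] _] Sv Sw; apply/set_mem/SP; apply/mem_set.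
Qed.

Lemma closed_subspaceD S v w : closed_subspace S -> S v -> S w -> S (v + w).
Proof. by move=> SC Sv Sw; rewrite -[v]scale1r; exact: closed_subspaceDZ. Qed.

Lemma closed_subspaceZ S a v : closed_subspace S -> S v -> S (a *: v).
Proof.
move=> SC Sv; rewrite -[_ *: _]addr0; apply: closed_subspaceDZ => //.
exact: closed_subspace0.
Qed.

Lemma closed_subspaceB S v w : closed_subspace S -> S v -> S w -> S (v - w).
Proof.
by move=> SC Sv Sw; rewrite addrC -scaleN1r; exact: closed_subspaceDZ.
Qed.

Lemma le_norm_on S phi v :
  closed_subspace S -> S v -> phi v <= norm_on S phi * `|v|.
Proof.
move=> SC Sv; have [->|v0] := eqVneq v 0; first by rewrite dual0 normr0 mulr0.
have nv : 0 < `|v| by rewrite normr_gt0.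
rewrite -[v in phi v](scalerKV (a := `|v|)) ?gt_eqF// dualZr mulrC ler_pM2r//.
apply: ub_le_sup; first exact: norm_on_ubound.
exists (`|v|^-1 *: v) => //; split; first exact: closed_subspaceZ.
by rewrite normrZ normfV normr_id mulVf// gt_eqF.
Qed.

Lemma norm_on_le S phi c :
  0 <= c -> (forall v, S v -> (phi v : R) <= c * `|v|) -> norm_on S phi <= c.
Proof.
move=> c0 cP; rewrite /norm_on; set A := image _ _.
have [->|/set0P A0] := eqVneq A set0; first by rewrite sup0.
apply: ge_sup => // _ [w [Sw w1] <-].
by rewrite (le_trans (cP w Sw))// w1 mulr1.
Qed.

Lemma norm_on_ge0 S phi : closed_subspace S -> 0 <= norm_on S phi.
Proof.
move=> SC; rewrite /norm_on; set A := image _ _.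
have [->|/set0P [_ [w [Sw w1] _]]] := eqVneq A set0; first by rewrite sup0.
have := le_norm_on phi SC Sw.
have := le_norm_on phi SC (closed_subspaceZ (-1) SC Sw).
rewrite dualZr normrZ normrN1 w1 !mulr1 -/(norm_on S phi) /norm_on -/A.
lra.
Qed.

End DualForm.

(** The supremum in [operator_norm] is 0 for an unbounded map, so continuity is
    what makes it an operator norm. *)
Lemma le_operator_norm (R : realType) (X Y : normedModType R)
    (f : {linear X -> Y}) h :
  continuous f -> `|f h| <= operator_norm f * `|h|.
Proof.
move=> /linear_bounded_continuous/linear_boundedP/pinfty_ex_gt0[k _ kP].
have [->|h0] := eqVneq h 0; first by rewrite raddf0 !normr0 mulr0.
have nh : 0 < `|h| by rewrite normr_gt0.
rewrite -[h in f h](scalerKV (a := `|h|)) ?gt_eqF// linearZ normrZ normr_id.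
rewrite mulrC ler_pM2r//; apply: ub_le_sup.
  by exists k => _ [w w1 <-]; rewrite (le_trans (kP w))// w1 mulr1.
by exists (`|h|^-1 *: h) => //=; rewrite normrZ normfV normr_id mulVf// gt_eqF.
Qed.

(** * Riesz representation and the Lax-Milgram theorem *)

Section Hilbert.
Variables (R : realType) (X : completeNormedModType R).
Variable ip : {dot X for @idfun R}.
Hypothesis norm_ip : forall x : X, `|x| = Num.sqrt (ip x x).
Implicit Types (S : set X) (u v w : X) (ell : dual X).

Lemma ipC u v : ip u v = ip v u.
Proof. by rewrite hermC expr0 mul1r. Qed.

Lemma ipBl u v w : ip (u - v) w = ip u w - ip v w.
Proof. by rewrite linearBl. Qed.

Lemma ipZl a u v : ip (a *: u) v = a * ip u v.
Proof. by rewrite linearZl_LR. Qed.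

Lemma normr_sqr_ip v : `|v| ^+ 2 = ip v v.
Proof.
rewrite norm_ip sqr_sqrtr//; have [->|v0] := eqVneq v 0.
  by rewrite linear0l.
by apply: ltW; exact: neq0_dnorm_gt0.
Qed.

Lemma normr_sqrD v w : `|v + w| ^+ 2 = `|v| ^+ 2 + 2 * ip v w + `|w| ^+ 2.
Proof.
rewrite !normr_sqr_ip linearDl !linearDr/= (ipC w v).
by ring.
Qed.

Lemma normr_sqrB v w : `|v - w| ^+ 2 = `|v| ^+ 2 - 2 * ip v w + `|w| ^+ 2.
Proof. by rewrite normr_sqrD normrN linearNr mulrN. Qed.

(** The representative is the minimiser over S of J v = |v|^2 - 2 ell v. By the
    parallelogram law near-minimisers are close to each other, so a minimising
    sequence converges, and its limit stays in the closed set S; the first order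
    condition at the limit is the claim. *)
Lemma riesz S ell : closed_subspace S ->
  exists2 z, S z & forall v, S v -> ip z v = ell v.
Proof.
move=> SC.
pose J (v : X) : R := `|v| ^+ 2 - @GRing.mul R 2 (ell v).
pose E := [set J v | v in S].
have E0 : E !=set0 by exists (J 0), 0 => //; exact: closed_subspace0.
have EJ v : S v -> E (J v) by move=> Sv; exists v.
have lbE : lbound E (- `|ell| ^+ 2).
  move=> _ [v Sv <-]; rewrite /J.
  have := dual_le ell v; have := sqr_ge0 (`|v| - `|ell|) => *; nra.
have hinf : has_inf E by split => //; exists (- `|ell| ^+ 2).
set m := inf E.
have mJ v : S v -> m <= J v.
  by move=> Sv; apply: ge_inf; [exists (- `|ell| ^+ 2)|exact: EJ].
have close v w e : S v -> S w -> J v <= m + e -> J w <= m + e ->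
    `|v - w| ^+ 2 <= 4 * e.
  move=> Sv Sw Jv Jw.
  (* parallelogram law: |v - w|^2 = 2 J v + 2 J w - 4 J ((v + w) / 2) *)
  have := mJ _ (closed_subspaceZ 2^-1 SC (closed_subspaceD SC Sv Sw)).
  move: Jv Jw; rewrite /J normr_sqrB dualZr dualDr normrZ exprMn normr_sqrD.
  rewrite ger0_norm ?invr_ge0//.
  by move: (ell v : R) (ell w : R) => *; lra.
have /choice[x xP] n : exists x, S x /\ J x <= m + (n.+1%:R)^-1.
  have n0 : 0 < (n.+1%:R : R)^-1 by rewrite invr_gt0.
  have [_ [x Sx <-] /ltW] := inf_adherent n0 hinf.
  by exists x.
have x_near e : 0 < e -> \forall n \near \oo, J (x n) <= m + e.
  move=> e0; have [N _ NP] := near_infty_natSinv_lt (PosNum e0).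
  exists N => // n Nn; apply: (le_trans (xP n).2).
  by rewrite lerD2l ltW//; exact: NP.
have x_cvg : cvgn x.
  apply/cauchy_cvgP/cauchy_exP => e e0.
  pose d := (e / 4) ^+ 2.
  have d0 : 0 < d by rewrite exprn_gt0// divr_gt0.
  have [N _ NP] := x_near _ d0.
  exists (x N); exists N => // n /= Nn; rewrite -ball_normE /ball_ /=.
  have := close _ _ _ (xP N).1 (xP n).1 (NP N (leqnn N)) (NP n Nn).
  move=> le_d; rewrite -(ltr_pXn2r (n := 2)) ?nnegrE ?(ltW e0)//.
  by apply: le_lt_trans le_d _; rewrite /d; nra.
pose z := limn x.
have Sz : S z.
  have [_ cS] := SC; apply: (@closed_cvg _ _ _ _ x S cS _ z x_cvg).
  by apply: nearW => n; exact: (xP n).1.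
have Jx : J (x n) @[n --> \oo] --> J z.
  apply: cvgB.
    exact: (cvgM (cvg_norm x_cvg) (cvg_norm x_cvg)).
  apply: cvgM; first exact: cvg_cst.
  have ell_z := @dual_continuous R X ell z.
  exact: (@cvg_comp _ _ _ x ell _ _ _ x_cvg ell_z).
have Jz : J z <= m.
  apply/ler_addgt0Pr => e e0.
  have cl := @closed_le R (m + e).
  exact: (@closed_cvg _ _ _ _ _ _ cl (x_near _ e0) _ Jx).
exists z => // v Sv.
pose c := ip z v - ell v.
have var t : 0 <= 2 * t * c + t ^+ 2 * `|v| ^+ 2.
  have := mJ _ (closed_subspaceDZ t SC Sv Sz).
  move/(le_trans Jz); rewrite /J normr_sqrD dualDr dualZr normrZ exprMn.
  rewrite real_normK ?num_real// ipZl (ipC v z) /c.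
  by move: (ell v : R) (ell z : R) => *; lra.
apply/eqP; rewrite -subr_eq0 -/c; apply/eqP.
have [v0|v0] := eqVneq `|v| 0.
  have := var 1; have := var (-1); rewrite v0 => *; lra.
(* the minimum over t of the quadratic in [var] *)
have := var (- c / `|v| ^+ 2).
rewrite (_ : _ + _ = - (c ^+ 2 / `|v| ^+ 2)); last by field.
have v2 : 0 < `|v| ^+ 2 by rewrite exprn_gt0// lt_def v0 normr_ge0.
rewrite oppr_ge0 pmulr_lle0 ?invr_gt0//.
by move=> c2; apply/eqP; rewrite -sqrf_eq0 eq_le c2 sqr_ge0.
Qed.

(** With g x the Riesz representative of B x - ell on S, a solution is a fixed
    point of x |-> x - t g x. Coercivity and boundedness make this a contraction
    for small t > 0: the increments satisfy
      |d - t w|^2 <= (1 - 2 t beta + t^2 K^2) |d|^2,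
    and t = beta / K^2 gives the best factor, 1 - (beta / K)^2. The form B may
    be non-symmetric, as the derivative of A is in general. *)
Lemma lax_milgram S (B : {linear X -> dual X}) (K beta : R) ell :
  closed_subspace S -> 0 < beta ->
  (forall v, `|B v| <= K * `|v|) ->
  (forall v, S v -> beta * `|v| ^+ 2 <= B v v) ->
  exists2 x, S x & forall v, S v -> B x v = ell v.
Proof.
move=> SC beta0 BK Bc.
have /choice[g gP] x : exists g, S g /\ forall v, S v -> ip g v = B x v - ell v.
  by have [z Sz zP] := riesz (B x - ell) SC; exists z.
(* enlarging K makes the contraction factor nonnegative *)
wlog Kb : K BK / beta < K.
  move=> /(_ (Num.max K (beta + 1))); apply => [v|]; last first.
    by rewrite lt_max ltrDl ltr01 orbT.
  by rewrite (le_trans (BK v))// ler_wpM2r// le_max lexx.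
have K0 : 0 < K by exact: lt_trans Kb.
pose t := beta / K ^+ 2.
pose q2 := 1 - (beta / K) ^+ 2.
have q20 : 0 <= q2.
  have r0 : 0 <= beta / K by rewrite divr_ge0// ltW.
  by rewrite subr_ge0 expr_le1// ler_pdivrMr// mul1r ltW.
pose h x := x - t *: g x.
have hS : {homo h : x / S x >-> S x}.
  move=> x Sx; apply: closed_subspaceB => //; apply: closed_subspaceZ => //.
  exact: (gP x).1.
have h_lip x y : S x -> S y -> `|h x - h y| ^+ 2 <= q2 * `|x - y| ^+ 2.
  move=> Sx Sy.
  set d := x - y; set w := g x - g y.
  have Sd : S d by exact: closed_subspaceB.
  have Sw : S w.
    by apply: closed_subspaceB => //; [exact: (gP x).1|exact: (gP y).1].
  have ipw v : S v -> ip w v = B d v.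
    move=> Sv; rewrite ipBl !(gP _).2// (raddfB B x y) dualBl.
    by move: (B x v : R) (B y v : R) (ell v : R) => a b c; ring.
  have -> : h x - h y = d - t *: w.
    by rewrite /h /d /w scalerBr !opprD !opprK addrACA.
  rewrite normr_sqrB (ipC d) ipZl ipw// normrZ exprMn real_normK ?num_real//.
  have wle : `|w| <= K * `|d|.
    have [->|w0] := eqVneq `|w| 0; first by rewrite mulr_ge0// ltW.
    have wp : 0 < `|w| by rewrite lt_def w0 /=.
    rewrite -(ler_pM2r wp) -expr2 normr_sqr_ip ipw//.
    by rewrite (le_trans (dual_le _ _))// ler_wpM2r.
  have := Bc _ Sd.
  move: wle; rewrite -(ler_pXn2r (n := 2)) ?nnegrE ?mulr_ge0// ?(ltW K0)//.
  rewrite exprMn.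
  move: (B d d : R) (`|d| ^+ 2) (`|w| ^+ 2) => b D W WD Db.
  have : t ^+ 2 * W <= t ^+ 2 * (K ^+ 2 * D) by rewrite ler_wpM2l ?sqr_ge0.
  have : t * (beta * D) <= t * b.
    by rewrite ler_wpM2l// divr_ge0 ?ltW// exprn_gt0.
  have -> : t ^+ 2 * (K ^+ 2 * D) = t * (beta * D).
    by rewrite /t; field; rewrite gt_eqF.
  have -> : q2 * D = D - t * (beta * D).
    by rewrite /q2 /t; field; rewrite gt_eqF.
  move=> *; lra.
pose q := Num.sqrt q2.
have q0 : 0 <= q by exact: sqrtr_ge0.
pose hf : {fun S >-> S} := mkfun_fun hS.
have q1 : q < 1.
  by rewrite -sqrtr1 ltr_sqrt// /q2 ltrBlDr ltrDl exprn_gt0// divr_gt0.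
have [] := @banach_fixed_point R X S hf.
- exists (NngNum q0); split => //=.
  move=> [x y] /= [Sx Sy].
  rewrite -(ler_pXn2r (n := 2)) ?nnegrE ?mulr_ge0// exprMn sqr_sqrtr//.
  exact: h_lip.
- by case: SC.
- by exists 0; exact: closed_subspace0.
move=> p Sp /eqP.
rewrite /= /h eq_sym -subr_eq0 addrAC subrr add0r oppr_eq0 scaler_eq0.
rewrite gt_eqF/= ?divr_gt0 ?exprn_gt0// => /eqP gp0.
exists p => // v Sv; have := (gP p).2 v Sv.
by rewrite gp0 linear0l => /esym/eqP; rewrite subr_eq0 => /eqP.
Qed.

End Hilbert.

(** * The residual along the Newton direction *)

Section Newton.
Variables (R : realType) (X : normedModType R).
Implicit Types (S : set X) (phi : dual X) (A : X -> dual X) (u v w rho : X).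

Lemma dual_norm_le phi v : `|phi v| <= `|phi| * `|v|.
Proof.
rewrite ler_norml dual_le andbT lerNl -(mulN1r (phi v)).
by rewrite -[leLHS](dualZr phi) (le_trans (dual_le _ _))// normrZ normrN1 mul1r.
Qed.

Lemma evaluation_continuous v : continuous (fun phi => phi v : R).
Proof.
move=> phi; apply/(cvgrPdist_le (FF := nbhs_filter phi)) => e e0.
have nv : 0 < `|v| + 1 by rewrite ltr_wpDl.
apply/nbhs_normP; exists (e / (`|v| + 1)) => /=; first by rewrite divr_gt0.
move=> psi /=; rewrite ltr_pdivlMr// => /ltW; apply: le_trans.
rewrite -[X in `|X|]/((phi - psi) v) (le_trans (dual_norm_le _ _))//.
by rewrite ler_wpM2l// lerDl.
Qed.

(** A composition of the directional derivative of A with the evaluation at w,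
    which turns the operator A into a real function of one variable. *)
Lemma is_derive_along A v w rho (s : R) : differentiable A (v + s *: rho) ->
  is_derive s 1 (fun t => A (v + t *: rho) w : R)
    ('d A (v + s *: rho) rho w).
Proof.
move=> Ad; set x := v + s *: rho.
have quot : (fun h : R => h^-1 *: (A (h *: rho + x) - A x)) @ 0^' -->
    'd A x rho.
  by rewrite -deriveE//; exact: (@diff_derivable R X (dual X) A x rho Ad).
pose g t : R := A (v + t *: rho) w.
have gquot : (fun h : R => h^-1 *: (g (h *: (1 : R) + s) - g s)) @ 0^' -->
    ('d A x rho w : R).
  have := cvg_comp _ _ quot (@evaluation_continuous w ('d A x rho)).
  apply: cvg_trans; apply: near_eq_cvg; near=> h => /=.
  rewrite -[LHS]/(h^-1 * (A (h *: rho + x) w - A x w)) /g /x.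
  by rewrite scalerDl addrCA [_%:A]mulr1.
apply: DeriveDef; first by apply/cvg_ex; exists ('d A x rho w).
exact/cvg_lim.
Unshelve. all: by end_near. Qed.

(** Taylor's formula of first order with Lipschitz remainder, tested with v in
    S. On S the Newton equation identifies the first order term with the
    residual, hence the factor 1 - delta. With f(t) = A (u + t rho) v, c its slope
    at 0 and k = K |rho|^2 |v|, the function f(t) - t c + (k / 2) t^2 has a
    nonnegative derivative; the mean value theorem for it replaces an integral
    remainder and still yields the constant K / 2. *)
Lemma newton_residual_le S A (F : dual X) u rho (K delta : R) :
  (forall v, differentiable A v) -> closed_subspace S ->
  newton_update A F S u rho -> 0 <= K -> 0 <= delta -> delta <= 1 ->
  (forall s, 0 <= s -> s <= delta ->
    operator_norm (fun h => 'd A u h - 'd A (u + s *: rho) h : dual X)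
      <= K * (s * `|rho|)) ->
  residual A F S (u + delta *: rho)
    <= (1 - delta) * residual A F S u + K * (delta * `|rho|) ^+ 2 / 2.
Proof.
move=> Ad SC [Srho rhoP] K0 d0 d1 dA_lip.
have r0 : 0 <= residual A F S u by exact: norm_on_ge0.
apply: norm_on_le => [|v Sv].
  by rewrite addr_ge0 ?mulr_ge0 ?subr_ge0 ?sqr_ge0// invr_ge0.
rewrite -[leLHS]/(F v - A (u + delta *: rho) v : R).
pose c : R := 'd A u rho v.
pose k : R := K * `|rho| ^+ 2 * `|v|.
pose f t : R := A (u + t *: rho) v.
pose phi t : R := f t - t * c + k / 2 * t ^+ 2.
pose dphi t : R := 'd A (u + t *: rho) rho v - c + k * t.
have phi' (t : R) : is_derive t 1 phi (dphi t).
  have f' : is_derive t 1 f ('d A (u + t *: rho) rho v).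
    exact: is_derive_along.
  apply: is_derive_eq.
  rewrite /dphi; move: ('d A (u + t *: rho) rho v : R) => a.
  by rewrite /GRing.scale /=; field.
have [|t /[!in_itv]/= /andP[t0 td]] := MVT_segment d0 (fun t _ => phi' t).
  apply: derivable_within_continuous => t _; exact: ex_derive.
have dphi0 : 0 <= dphi t.
  pose D : {linear X -> dual X} := 'd A u \- 'd A (u + t *: rho).
  have Dc : continuous D.
    by move=> x; apply: cvgB; apply: diff_continuous.
  have : `|D rho| <= K * (t * `|rho|) * `|rho|.
    apply: le_trans (le_operator_norm rho Dc) _.
    by rewrite ler_wpM2r//; exact: dA_lip.
  move=> /(ler_wpM2r (normr_ge0 v)).
  move=> /(le_trans (dual_le (D rho) v)).
  rewrite -[D rho v]/(c - 'd A (u + t *: rho) rho v : R) /dphi.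
  have -> : K * (t * `|rho|) * `|rho| * `|v| = k * t by rewrite /k; ring.
  by move: ('d A (u + t *: rho) rho v : R) => a; lra.
rewrite subr0 => phiE.
have : 0 <= dphi t * delta by rewrite mulr_ge0.
rewrite -phiE /phi /f scale0r addr0.
have cE : c = F v - A u v :> R by exact: rhoP.
have : (1 - delta) * c <= (1 - delta) * residual A F S u * `|v|.
  by rewrite -mulrA ler_wpM2l ?subr_ge0// [c]rhoP//; exact: le_norm_on.
rewrite (mulrDl (_ * residual _ _ _ _)).
rewrite (_ : _ / 2 * `|v| = k / 2 * delta ^+ 2); last by rewrite /k; field.
rewrite cE.
move: (A (u + _) v : R) (A u v : R) (F v : R) => a b e.
by move: ((1 - delta) * residual A F S u * `|v|) => r *; lra.
Qed.

End Newton.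

(** * The damping loop *)

Section HalfPowers.
Variable R : realType.

Local Notation half := (2^-1 : R).

Lemma half_powS i : half ^+ i / 2 = half ^+ i.+1.
Proof. by rewrite exprSr. Qed.

Lemma half_pow_le1 i : half ^+ i <= 1.
Proof. by rewrite exprn_ile1// ?invr_ge0// invf_le1// ler1n. Qed.

Lemma ler_half_pow i j : (half ^+ i <= half ^+ j) = (j <= i)%N.
Proof. by rewrite ler_iXn2l// ?invr_gt0// invf_lt1// ltr1n. Qed.

Lemma min_half_pow i j :
  Num.min (half ^+ i) (half ^+ j) = half ^+ maxn i j.
Proof.
case: (leqP i j) => ij; first by rewrite (elimT min_idPr)// ler_half_pow.
by rewrite (elimT min_idPl)// ler_half_pow ltnW.
Qed.

(** The values lie in the finite set of the powers 2^-i with i <= J, so the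
    infimum is attained, at the largest exponent that occurs. *)
Lemma is_minimum_half_pow (a : nat -> R) J :
  (forall k, exists2 i, a k = half ^+ i & (i <= J)%N) ->
  exists m, is_minimum a m /\ half ^+ J <= m.
Proof.
move=> aP.
have /choice[i iP] k : exists i, a k = half ^+ i /\ (i <= J)%N.
  by have [i] := aP k; exists i.
have aE k : a k = half ^+ i k by have [] := iP k.
have iJ k : (i k <= J)%N by have [] := iP k.
have ex : exists n, `[< exists k, i k = n >].
  by exists (i 0%N); apply/asboolP; exists 0%N.
have ub n : `[< exists k, i k = n >] -> (n <= J)%N by move=> /asboolP[k <-].
have [n /asboolP[k kn] nmax] := ex_maxnP ex ub.
exists (a k); split; last by rewrite aE ler_half_pow.
split=> [|l]; first by exists k.
by rewrite !aE ler_half_pow kn; apply: nmax; apply/asboolP; exists l.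
Qed.

Lemma powR_threehalf_le (d : R) : 0 < d -> d <= 1 -> d `^ (3 / 2) <= d.
Proof. by move=> d0 d1; apply: ge1r_powR; rewrite ?d0//; lra. Qed.

End HalfPowers.

Section Damping.
Variables (R : realType) (X : normedModType R).
Variables (A : X -> dual X) (F : dual X) (S : set X) (u rho : X) (J : nat).

Local Notation half := (2^-1 : R).

(** Once C delta <= 1/2 the quadratic term costs at most half of the gain delta,
    and the other half dominates dmin^(3/2) / 2. *)
Lemma reduction_criterion_le (C delta dmin : R) :
  0 < dmin -> dmin <= delta -> delta <= 1 -> C * delta <= 1 / 2 ->
  0 <= residual A F S u ->
  residual A F S (u + delta *: rho)
    <= (1 - delta + C * delta ^+ 2) * residual A F S u ->
  reduction_criterion A F S u rho delta dmin.
Proof.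
move=> dmin0 dle d1 Cd r0 /le_trans; apply; apply: ler_wpM2r => //.
have := powR_threehalf_le dmin0 (le_trans dle d1).
have d0 := lt_le_trans dmin0 dle.
have : C * delta * delta <= 1 / 2 * delta by rewrite ler_pM2r.
rewrite expr2; lra.
Qed.

Hypothesis criterion_small : forall i,
  (J <= i)%N -> reduction_criterion A F S u rho (half ^+ J) (half ^+ i).

Lemma halving_exponent_lt i j : (j <= i)%N -> (i <= J)%N ->
  ~ reduction_criterion A F S u rho (half ^+ j) (half ^+ i) -> (j < J)%N.
Proof.
move=> ji iJ; rewrite ltnNge => ncrit; apply/negP => Jj; apply: ncrit.
have -> : j = J by apply/eqP; rewrite eqn_leq Jj (leq_trans ji).
by apply: criterion_small; rewrite (leq_trans Jj).
Qed.

(** As dmin never exceeds delta, the two values can be tracked by exponents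
    j <= i, and a halving acts on them as (j, i) |-> (j + 1, max (j + 1) i). *)
Lemma damping_invariant (delta dmin delta' dmin' : R) i j :
  damping A F S u rho delta dmin delta' dmin' ->
  delta = half ^+ j -> dmin = half ^+ i -> (j <= i)%N -> (i <= J)%N ->
  reduction_criterion A F S u rho delta' dmin' /\
  exists2 i', dmin' = half ^+ i' & (i' <= J)%N.
Proof.
move=> D; elim: D i j => {delta dmin delta' dmin'}
  [delta dmin crit|delta dmin delta' dmin' ncrit _ IH] i j deltaE dminE ji iJ.
  by split=> //; exists i.
have jJ : (j < J)%N.
  by apply: (halving_exponent_lt ji iJ); rewrite -deltaE -dminE.
apply: (IH (maxn j.+1 i) j.+1).
- by rewrite deltaE half_powS.
- by rewrite deltaE dminE half_powS min_half_pow.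
- exact: leq_maxl.
- by rewrite geq_max jJ.
Qed.

Lemma damping_terminates i j : (j <= i)%N -> (i <= J)%N ->
  exists delta' dmin', damping A F S u rho (half ^+ j) (half ^+ i) delta' dmin'.
Proof.
move=> + iJ; have [n] := ubnP (J - j)%N.
elim: n i j iJ => // n IH i j iJ nj ji.
have [crit|ncrit] := pselect
    (reduction_criterion A F S u rho (half ^+ j) (half ^+ i)).
  by exists (half ^+ j), (half ^+ i); exact: damping_stop.
have jJ := halving_exponent_lt ji iJ ncrit.
have [|||delta' [dmin' D]] := IH (maxn j.+1 i) j.+1.
- by rewrite geq_max jJ.
- by rewrite -ltnS (leq_trans _ nj)// ltnS ltn_sub2l.
- exact: leq_maxl.
exists delta', dmin'; apply: damping_halve => //.
by rewrite half_powS min_half_pow.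
Qed.

End Damping.

(** * Bounds that do not depend on the subspace *)

Section Estimates.
Variables (R : realType) (X : normedModType R).
Variables (A : X -> dual X) (F : dual X) (alpha beta : R) (L M : R -> R).
Hypothesis A_diff : forall v, differentiable A v.
Hypothesis alpha_gt0 : 0 < alpha.
Hypothesis A_mono : forall v w,
  alpha * `|v - w| ^+ 2 <= (A v - A w : dual X) (v - w).
Hypothesis A_lip : forall th, 0 < th -> forall v w phi : X,
  Num.max `|v| `|v - w| <= th ->
  (A v - A w : dual X) phi <= L th * `|v - w| * `|phi|.
Hypothesis beta_gt0 : 0 < beta.
Hypothesis dA_coercive : forall v w, beta * `|w| ^+ 2 <= ('d A v w : dual X) w.
Hypothesis M_gt0 : forall th, 0 < th -> 0 < M th.
Hypothesis dA_lip : forall th, 0 < th -> forall v w : X,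
  Num.max `|v| `|v - w| <= th ->
  operator_norm (fun h => 'd A v h - 'd A w h : dual X) <= M th * `|v - w|.
Implicit Types (S : set X) (u v rho : X) (th : R).

Local Notation B0 := (alpha^-1 * `|F - A 0|).
Local Notation r S u := (residual A F S u).

(** Monotonicity between u and 0, tested with u itself, bounds alpha |u|^2 by
    (A u - A 0) u = (F - A 0) u - (F - A u) u. As u lies in S, the last term is
    controlled by the residual on S. *)
Lemma norm_le_residual S u : closed_subspace S -> S u ->
  `|u| <= alpha^-1 * r S u + B0.
Proof.
move=> SC Su.
have [->|u0] := eqVneq `|u| 0.
  by rewrite addr_ge0// mulr_ge0 ?invr_ge0 ?(ltW alpha_gt0)// norm_on_ge0.
have nu : 0 < `|u| by rewrite lt_def u0 normr_ge0.
rewrite -mulrDr ler_pdivlMl// -(ler_pM2r nu) -mulrA -expr2.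
have := A_mono u 0; rewrite subr0 => /le_trans; apply.
rewrite -[leLHS]/(A u u - A 0 u : R).
have := le_norm_on (F - A u) SC (closed_subspaceZ (-1) SC Su).
rewrite dualZr normrZ normrN1 mul1r -[(F - A u) u]/(F u - A u u : R).
rewrite -/(residual A F S u).
have := dual_le (F - A 0) u.
rewrite -[X in X <= _ -> _]/(F u - A 0 u : R).
move: (F u : R) (A u u : R) (A 0 u : R) => a b c; rewrite mulrDl.
move: (r S u * _) (`|F - A 0| * _) => *; lra.
Qed.

(** For |w| = th the pairing of A w - A 0 with w is at least alpha th^2 by
    monotonicity and at most L[th] th^2 by the Lipschitz bound. *)
Lemma monotonicity_le_lipschitz v th : v != 0 -> 0 < th -> alpha <= L th.
Proof.
move=> v0 th0.
have nv : 0 < `|v| by rewrite normr_gt0.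
pose w := (th / `|v|) *: v.
have nw : `|w| = th.
  by rewrite normrZ ger0_norm ?divfK ?gt_eqF// divr_ge0// ltW.
have := A_lip th0 (v := w) (w := 0) w; rewrite subr0 nw maxxx lexx => /(_ isT).
have := A_mono w 0; rewrite subr0 nw => /le_trans/[apply].
by rewrite expr2 mulrA !ler_pM2r.
Qed.

Lemma initial_gap_gt0 : A 0 <> F -> 0 < B0.
Proof.
move=> A0F; rewrite mulr_gt0 ?invr_gt0// normr_gt0 subr_eq0.
by apply/eqP => FA0; apply: A0F.
Qed.

(** Splitting F - A u at A 0, the two parts have norm alpha B0 and at most
    L[(1 + c0) B0] c0 B0; the comparison alpha <= L[(1 + c0) B0] merges them. *)
Lemma initial_residual_le S (c0 : R) u : A 0 <> F -> 0 < c0 ->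
  `|u| <= c0 * B0 -> r S u <= L ((1 + c0) * B0) * ((1 + c0) * B0).
Proof.
move=> A0F c0_gt0 uB; have B0_gt0 := initial_gap_gt0 A0F.
set th := (1 + c0) * B0.
have th0 : 0 < th by rewrite mulr_gt0// addr_gt0.
have [z z0] : exists z : X, z != 0.
  (* on the trivial space all functionals agree *)
  apply: contrapT => /forallNP X0; apply: A0F; apply: val_inj.
  apply/funext => z; by have /negP/negPn/eqP -> := X0 z; rewrite /= !dual0.
have aL := monotonicity_le_lipschitz z0 th0.
have L0 : 0 < L th by exact: lt_le_trans aL.
apply: norm_on_le => [|v _]; first by rewrite mulr_ge0// ltW.
rewrite -[leLHS]/(F v - A u v : R).
have : F v - A 0 v <= L th * B0 * `|v| :> R.
  apply: le_trans (dual_le (F - A 0) v) _; rewrite ler_wpM2r//.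
  by rewrite mulrA ler_peMl// ler_pdivlMr// mul1r.
have : A 0 v - A u v <= L th * (c0 * B0) * `|v| :> R.
  have := A_lip th0 (v := 0) (w := u) v.
  rewrite sub0r normrN normr0 (elimT max_idPr)// => /(_ _)/le_trans; apply.
    by rewrite (le_trans uB)// /th ler_pM2r// lerDr.
  by rewrite ler_wpM2r// ler_wpM2l// ltW.
move: (F v : R) (A u v : R) (A 0 v : R) => a b c h1 h2.
have -> : L th * th * `|v| = L th * (c0 * B0) * `|v| + L th * B0 * `|v|.
  by rewrite /th; ring.
lra.
Qed.

(** The Newton equation tested with the update itself. *)
Lemma newton_update_le S u rho : closed_subspace S ->
  newton_update A F S u rho -> `|rho| <= r S u / beta.
Proof.
move=> SC [Srho rhoP].
have [->|rho0] := eqVneq `|rho| 0; first by rewrite divr_ge0 ?norm_on_ge0// ltW.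
have nrho : 0 < `|rho| by rewrite lt_def rho0 normr_ge0.
rewrite ler_pdivlMr// mulrC -(ler_pM2r nrho) -mulrA -expr2.
apply: le_trans (dA_coercive u rho) _.
by rewrite rhoP//; exact: le_norm_on.
Qed.

(** The radius th makes the Lipschitz bound of the derivative valid on the whole
    segment from u to u + rho, as |rho| <= r(u) / beta <= th. *)
Lemma damped_residual_le S u rho th (delta : R) : closed_subspace S ->
  newton_update A F S u rho -> 0 < th -> `|u| <= th -> r S u / beta <= th ->
  0 <= delta -> delta <= 1 ->
  r S (u + delta *: rho) <=
    (1 - delta + M th / (2 * beta ^+ 2) * r S u * delta ^+ 2) * r S u.
Proof.
move=> SC rhoP th0 uth rth d0 d1.
have r0 : 0 <= r S u by exact: norm_on_ge0.
have rho_le := newton_update_le SC rhoP.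
have M0 := M_gt0 th0.
apply: le_trans (newton_residual_le A_diff SC rhoP (ltW M0) d0 d1 _) _.
  move=> s s0 sd; have := dA_lip th0 (v := u) (w := u + s *: rho).
  rewrite opprD addrA subrr sub0r normrN normrZ ger0_norm//; apply.
  rewrite ge_max uth (le_trans _ rth)// (le_trans _ rho_le)//.
  by rewrite ler_piMl// (le_trans sd).
rewrite [leRHS]mulrDl lerD2l.
have k0 : 0 <= M th * delta ^+ 2 / 2.
  by rewrite divr_ge0// mulr_ge0 ?sqr_ge0// ltW.
have -> : M th / (2 * beta ^+ 2) * r S u * delta ^+ 2 * r S u
    = M th * delta ^+ 2 / 2 * (r S u / beta) ^+ 2.
  by field; rewrite gt_eqF.
have -> : M th * (delta * `|rho|) ^+ 2 / 2
    = M th * delta ^+ 2 / 2 * `|rho| ^+ 2 by field.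
by rewrite ler_wpM2l// ler_pXn2r ?nnegrE// divr_ge0// ltW.
Qed.

End Estimates.

(** * Running the iteration *)

Section Iteration.
Variables (R : realType) (X : completeNormedModType R).
Variable ip : {dot X for @idfun R}.
Hypothesis norm_ip : forall x : X, `|x| = Num.sqrt (ip x x).
Variables (A : X -> dual X) (F : dual X) (beta : R) (S : set X).
Hypothesis A_diff : forall v, differentiable A v.
Hypothesis beta_gt0 : 0 < beta.
Hypothesis dA_coercive : forall v w, beta * `|w| ^+ 2 <= ('d A v w : dual X) w.
Hypothesis S_closed : closed_subspace S.

Lemma newton_update_exists u : exists rho, newton_update A F S u rho.
Proof.
have dAc := diff_continuous (A_diff u).
have [x Sx xP] := lax_milgram norm_ip (F - A u) S_closed beta_gt0
  (fun v => le_operator_norm v dAc) (fun v _ => dA_coercive u v).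
by exists x.
Qed.

Variables (R0 C : R) (J : nat).
Hypothesis CJ : C * 2^-1 ^+ J <= 1 / 2.
Hypothesis residual_decay : forall u rho (delta : R), S u ->
  newton_update A F S u rho -> residual A F S u <= R0 ->
  0 <= delta -> delta <= 1 ->
  residual A F S (u + delta *: rho)
    <= (1 - delta + C * delta ^+ 2) * residual A F S u.

(** The invariant of the iteration: i is the exponent of the current
    dmin = 2^-i. *)
Definition admissible u i :=
  [/\ S u, residual A F S u <= R0 & (i <= J)%N].

Lemma admissible_criterion u i0 rho i : admissible u i0 ->
  newton_update A F S u rho -> (J <= i)%N ->
  reduction_criterion A F S u rho (2^-1 ^+ J) (2^-1 ^+ i).
Proof.
move=> [Su uR _] rhoP Ji.
have J1 := half_pow_le1 R J.
apply: (@reduction_criterion_le _ _ _ _ _ _ _ C) => //.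
- by rewrite ler_half_pow.
- exact: norm_on_ge0.
- by apply: residual_decay => //; rewrite exprn_ge0// invr_ge0.
Qed.

(** The criterion is met with the updated dmin = 2^-i', which is at least 2^-J;
    this is where the step-dependent reduction factor becomes uniform. *)
Lemma admissible_step u i rho (delta d' : R) : admissible u i ->
  newton_update A F S u rho ->
  damping A F S u rho 1 (2^-1 ^+ i) delta d' ->
  exists i', [/\ d' = 2^-1 ^+ i', admissible (u + delta *: rho) i'
    & residual A F S (u + delta *: rho)
        <= (1 - (2^-1 ^+ J) `^ (3 / 2) / 2) * residual A F S u].
Proof.
move=> uP rhoP D; have [Su uR iJ] := uP.
have r0 : 0 <= residual A F S u by exact: norm_on_ge0.
have [crit [i' d'E i'J]] := damping_invariant
  (fun i => admissible_criterion uP rhoP) D (esym (expr0 _)) erefl (leq0n i) iJ.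
have dec : residual A F S (u + delta *: rho)
    <= (1 - (2^-1 ^+ J) `^ (3 / 2) / 2) * residual A F S u.
  apply: le_trans crit _; apply: ler_wpM2r => //.
  rewrite lerD2l lerN2 ler_pM2r ?invr_gt0// d'E.
  apply: ge0_ler_powR; rewrite ?nnegrE ?exprn_ge0 ?invr_ge0 ?divr_ge0//.
  by rewrite ler_half_pow.
exists i'; split=> //; split=> //.
  by apply: closed_subspaceD => //; apply: closed_subspaceZ => //; case: rhoP.
apply: le_trans dec _; apply: le_trans uR.
by rewrite ler_piMl// gerBl divr_ge0// powR_ge0.
Qed.

Lemma admissible_next u i : admissible u i ->
  exists rho (delta d' : R), newton_update A F S u rho /\
    damping A F S u rho 1 (2^-1 ^+ i) delta d'.
Proof.
move=> uP; have [rho rhoP] := newton_update_exists u.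
have [_ _ iJ] := uP.
have [delta [d' D]] := damping_terminates
  (fun i => admissible_criterion uP rhoP) (leq0n i) iJ.
by exists rho, delta, d'.
Qed.

Lemma damped_newton_exists u0 : admissible u0 1 ->
  exists u rho delta dmin, damped_newton A F S u0 u rho delta dmin.
Proof.
move=> u0P.
(* a state is (u_k, dmin_k), and a step also records (rho_k, delta_k) *)
have step (s : X * R) : exists t : (X * R) * (X * R),
    (exists2 i, s.2 = 2^-1 ^+ i & admissible s.1 i) ->
    [/\ newton_update A F S s.1 t.2.1,
        damping A F S s.1 t.2.1 1 s.2 t.2.2 t.1.2,
        t.1.1 = s.1 + t.2.2 *: t.2.1
      & exists2 i, t.1.2 = 2^-1 ^+ i & admissible t.1.1 i].
  have [[i sE sP]|nP] :=
      pselect (exists2 i, s.2 = 2^-1 ^+ i & admissible s.1 i).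
    have [rho [delta [d' [rhoP D]]]] := admissible_next sP.
    have [i' [d'E uP _]] := admissible_step sP rhoP D.
    exists (s.1 + delta *: rho, d', (rho, delta)) => _ /=.
    by rewrite sE; split => //; exists i'.
  by exists (s, s).
have [f fP] := choice step.
pose st k := iter k (fun s => (f s).1) (u0, 1 / 2).
have stP k : exists2 i, (st k).2 = 2^-1 ^+ i & admissible (st k).1 i.
  elim: k => [|k /fP[_ _ _]]; last by [].
  by exists 1%N => //=; rewrite expr1 mul1r.
exists (fun k => (st k).1), (fun k => (f (st k)).2.1),
  (fun k => (f (st k)).2.2), (fun k => (st k).2).
by split=> // k; have [] := fP _ (stP k).
Qed.

Lemma damped_newton_invariant u0 u rho (delta dmin : nat -> R) :
  admissible u0 1 -> damped_newton A F S u0 u rho delta dmin ->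
  forall k,
    [/\ exists2 i, dmin k = 2^-1 ^+ i & (i <= J)%N,
        S (u k), residual A F S (u k) <= R0
      & residual A F S (u k.+1)
          <= (1 - (2^-1 ^+ J) `^ (3 / 2) / 2) * residual A F S (u k)].
Proof.
move=> u0P [u0E dmin0E upd damp stepE].
have inv k : exists2 i, dmin k = 2^-1 ^+ i & admissible (u k) i.
  elim: k => [|k [i dE uP]].
    by exists 1%N; rewrite ?u0E// dmin0E expr1 mul1r.
  have := damp k; rewrite dE => /(admissible_step uP (upd k))[i' [-> uP' _]].
  by exists i'; rewrite ?stepE.
move=> k; have [i dE uP] := inv k; have [Su uR iJ] := uP.
have := damp k; rewrite dE => /(admissible_step uP (upd k))[i' [_ _ dec]].
by split=> //; [exists i|rewrite stepE].
Qed.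

End Iteration.

Lemma geometric_eventually_le (R : realType) (z a e : R) :
  0 <= z -> z < 1 -> 0 < e ->
  exists N, forall k, (N <= k)%N -> z ^+ k * a <= e.
Proof.
move=> z0 z1 e0.
have z_lt1 : `|z| < 1 by rewrite ger0_norm.
have /cvgr0_norm_le/(_ e e0)[N _ NP] := cvg_geometric a z_lt1.
exists N => k /NP; rewrite /= mulrC; exact: le_trans (ler_norm _).
Qed.

Theorem lemma6 (R : realType) (X : completeNormedModType R)
  (ip : {dot X for @idfun R})
  (norm_ip : forall x : X, `|x| = Num.sqrt (ip x x))
  (A : X -> dual X) (F : dual X) (alpha beta c0 : R) (L M : R -> R)
  (A_diff : forall v : X, differentiable A v)
  (alpha_gt0 : 0 < alpha)
  (A_mono : forall v w : X,
     alpha * `|v - w| ^+ 2 <= (A v - A w : dual X) (v - w))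
  (L_gt0 : forall th : R, 0 < th -> 0 < L th)
  (A_lip : forall th : R, 0 < th ->
     forall v w phi : X, Num.max `|v| `|v - w| <= th ->
     (A v - A w : dual X) phi <= L th * `|v - w| * `|phi|)
  (beta_gt0 : 0 < beta)
  (dA_coercive : forall v w : X,
     beta * `|w| ^+ 2 <= ('d A v w : dual X) w)
  (M_gt0 : forall th : R, 0 < th -> 0 < M th)
  (dA_lip : forall th : R, 0 < th ->
     forall v w : X, Num.max `|v| `|v - w| <= th ->
     operator_norm (fun h : X => 'd A v h - 'd A w h : dual X)
       <= M th * `|v - w|)
  (M_mono : forall s t : R, 0 < s -> s <= t -> M s <= M t)
  (M_lbound : exists m : R, 0 < m /\ forall th : R, 0 < th -> m <= M th)
  (A0_neq_F : A 0 <> F)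
  (c0_gt1 : 1 < c0) :
  let B0 : R := alpha^-1 * `|F - A 0| in
  let Bbar0 : R := alpha^-1 * L ((1 + c0) * B0) * ((1 + c0) * B0) + B0 in
  exists (delta0 : R) (k0 : nat),
    let rbar0 : R := 1 - delta0 `^ (3 / 2) / 2 in
    [/\ 0 < delta0, rbar0 < 1 &
    forall XH : set X, closed_subspace XH ->
    forall uH0 : X, XH uH0 -> `|uH0| <= c0 * B0 ->
      (exists u rho delta dmin, damped_newton A F XH uH0 u rho delta dmin) /\
      (forall (u rho : nat -> X) (delta dmin : nat -> R),
        damped_newton A F XH uH0 u rho delta dmin ->
        [/\ forall k : nat, `|u k| <= Bbar0,
            exists delta_min : R,
              [/\ is_minimum dmin delta_min, 0 < delta_min
                & delta0 <= delta_min],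
            forall k : nat,
              residual A F XH (u k.+1) <= rbar0 * residual A F XH (u k)
          & forall k : nat, (k0 <= k)%N ->
              residual A F XH (u k + rho k) <=
                Num.min (1 - 2 `^ (- (5 / 2)))
                        (M Bbar0 / (2 * beta ^+ 2) * residual A F XH (u k))
                * residual A F XH (u k)])].
Proof.
move=> B0 Bbar0.
pose R0 := L ((1 + c0) * B0) * ((1 + c0) * B0).
have B0_gt0 : 0 < B0 := initial_gap_gt0 alpha_gt0 A0_neq_F.
have c0_gt0 : 0 < c0 := lt_trans ltr01 c0_gt1.
have R0_gt0 : 0 < R0.
  have th0 : 0 < (1 + c0) * B0 by rewrite mulr_gt0// addr_gt0.
  by rewrite mulr_gt0// L_gt0.
have Bbar0E : Bbar0 = alpha^-1 * R0 + B0.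
  by rewrite /Bbar0 /R0 (mulrA alpha^-1 (L _)).
have Bbar0_gt0 : 0 < Bbar0 by rewrite Bbar0E addr_gt0// mulr_gt0// invr_gt0.
(* R0 / beta bounds every Newton update *)
pose th := Num.max Bbar0 (R0 / beta).
have th0 : 0 < th by rewrite lt_max Bbar0_gt0.
pose C := M th / (2 * beta ^+ 2) * R0.
have beta2 : 0 < 2 * beta ^+ 2 by rewrite mulr_gt0// exprn_gt0.
(* 1 <= J because dmin starts at 1 / 2 *)
have [J J1 CJ] : exists2 J, (1 <= J)%N & C * 2^-1 ^+ J <= 1 / 2.
  have half1 : (2^-1 : R) < 1 by rewrite invf_lt1// ltr1n.
  have [|||N NP] := @geometric_eventually_le R 2^-1 C (1 / 2).
  - by rewrite invr_ge0.
  - exact: half1.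
  - by [].
  by exists (maxn N 1); rewrite ?leq_maxr// mulrC NP// leq_maxl.
pose delta0 : R := 2^-1 ^+ J.
pose rbar0 := 1 - delta0 `^ (3 / 2) / 2.
have delta0_gt0 : 0 < delta0 by rewrite exprn_gt0// invr_gt0.
have delta0_le1 : delta0 <= 1 by exact: half_pow_le1.
have pow_gt0 : 0 < delta0 `^ (3 / 2) by exact: powR_gt0.
have rbar0_lt1 : rbar0 < 1 by rewrite /rbar0 gtrBl divr_gt0.
have rbar0_ge0 : 0 <= rbar0.
  by have := powR_threehalf_le delta0_gt0 delta0_le1; rewrite /rbar0; lra.
pose q : R := 1 - 2 `^ (- (5 / 2)).
have q0 : 0 < q.
  rewrite /q subr_gt0 powRN invf_lt1 ?powR_gt0//.
  have := @gt0_ltr_powR R (5 / 2) ltac:(by []) 1 2.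
  by rewrite !nnegrE powR1 ltr1n => ->.
(* below eps both Bbar0 is an admissible radius and the quadratic factor is at
   most q *)
pose eps := Num.min (beta * Bbar0) (q * (2 * beta ^+ 2) / M Bbar0).
have eps0 : 0 < eps.
  by rewrite lt_min mulr_gt0//= divr_gt0 ?M_gt0// mulr_gt0.
have [k0 k0P] : exists k0, forall k, (k0 <= k)%N -> rbar0 ^+ k * R0 <= eps.
  exact: geometric_eventually_le.
exists delta0, k0; split=> // XH SC u0 Su0 u0B.
have r_ge0 v : 0 <= residual A F XH v by exact: norm_on_ge0.
have r0R : residual A F XH u0 <= R0.
  exact: (initial_residual_le alpha_gt0 A_mono A_lip XH A0_neq_F c0_gt0 u0B).
have bounded v : XH v -> residual A F XH v <= R0 -> `|v| <= Bbar0.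
  move=> Sv vR; apply: le_trans (norm_le_residual F alpha_gt0 A_mono SC Sv) _.
  by rewrite Bbar0E lerD2r ler_wpM2l// invr_ge0 ltW.
have decay v rho (delta : R) : XH v -> newton_update A F XH v rho ->
    residual A F XH v <= R0 -> 0 <= delta -> delta <= 1 ->
    residual A F XH (v + delta *: rho) <=
      (1 - delta + C * delta ^+ 2) * residual A F XH v.
  move=> Sv rhoP vR d0 d1.
  apply: le_trans (damped_residual_le A_diff beta_gt0 dA_coercive M_gt0 dA_lip
    SC rhoP th0 _ _ d0 d1) _.
  - by rewrite le_max bounded.
  - by rewrite le_max ler_pM2r ?invr_gt0// vR orbT.
  apply: ler_wpM2r => //; rewrite lerD2l ler_wpM2r ?sqr_ge0//.
  by rewrite ler_wpM2l// divr_ge0 ?ltW// M_gt0.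
have u0P : admissible A F XH R0 J u0 1 by [].
split.
  exact: (damped_newton_exists norm_ip A_diff beta_gt0 dA_coercive SC CJ decay
    u0P).
move=> u rho delta dmin uP.
have inv := damped_newton_invariant SC CJ decay u0P uP.
have decr k : residual A F XH (u k.+1) <= rbar0 * residual A F XH (u k).
  by have [] := inv k.
have geom k : residual A F XH (u k) <= rbar0 ^+ k * R0.
  elim: k => [|k IH]; first by rewrite expr0 mul1r (newton_init uP).
  by rewrite exprS -mulrA (le_trans (decr k))// ler_wpM2l.
have uB k : `|u k| <= Bbar0 by have [_ Su uR _] := inv k; exact: bounded.
split=> //.
  have [|m [mP mJ]] := @is_minimum_half_pow R dmin J.
    by move=> k; have [] := inv k.
  by exists m; split=> //; exact: lt_le_trans mJ.
move=> k kk0.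
have := le_trans (geom k) (k0P k kk0); rewrite le_min => /andP[rb rq].
have := damped_residual_le A_diff beta_gt0 dA_coercive M_gt0 dA_lip SC
  (newton_solve uP k) Bbar0_gt0 (uB k) _ ler01 (lexx 1).
rewrite scale1r subrr add0r expr1n mulr1 => /(_ _)/le_trans; apply.
  by rewrite ler_pdivrMr// mulrC.
apply: ler_wpM2r => //; rewrite le_min lexx andbT -/q.
by rewrite mulrC mulrA ler_pdivrMr// -ler_pdivlMr ?M_gt0.
Qed.
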